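(* Let $V$ be a finite dimensional vector space over a field $\mathbb{K}$. The family $\mathrm{Hom}_V=(\mathrm{Hom}(V^{\otimes k},V^{\otimes l}))_{k,l\ge 0}$, with the symmetric group actions, horizontal concatenation and partial trace maps described in the context, is a TRAP. It is unitary, with unit the identity map $\mathrm{Id}_V\in \mathrm{Hom}(V,V)$. In other words, $\mathrm{Hom}_V$ is a wheeled PROP (i.e. a unitary TRAP).
   Context: Notation: $\mathbb{N}_0=\{0,1,2,\dots\}$, $[k]=\{1,\dots,k\}$, $\mathfrak S_k$ is the symmetric group on $[k]$. TRAP. A TRAP is a family $P=(P(k,l))_{k,l\ge 0}$ of sets with: (1) for all $k,l\in\mathbb N_0$, a left action of $\mathfrak S_l$ and a right action of $\mathfrak S_k$ on $P(k,l)$ which commute (this is called an $\mathfrak S\times\mathfrak S^{op}$-module). (2) Maps $*:P(k,l)\times P(k',l')\to P(k+k',l+l')$ (horizontal concatenation) such that: $*$ is associative; there is $I_0\in P(0,0)$ with $I_0*p=p*I_0=p$; $(\sigma\cdot p\cdot\tau)*(\sigma'\cdot p'\cdot\tau')=(\sigma\otimes\sigma')\cdot(p*p')\cdot(\tau\otimes\tau')$, where for $\alpha\in\mathfrak S_m,\beta\in\mathfrak S_n$, $(\alpha\otimes\beta)(i)=\alpha(i)$ if $i\le m$ and $\beta(i-m)+m$ if $i>m$; and $c_{l,l'}\cdot(p*p')=(p'*p)\cdot c_{k,k'}$ for $p\in P(k,l)$, $p'\in P(k',l')$, where $c_{m,n}\in\mathfrak S_{m+n}$, $c_{m,n}(i)=i+n$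 if $i\le m$ and $i-m$ if $i>m$. (3) For $k,l\ge1$, $i\in[k]$, $j\in[l]$, maps $t_{i,j}:P(k,l)\to P(k-1,l-1)$ (partial trace maps) such that: (a) for $k,l\ge2$, $i\in[k]$, $j\in[l]$, $i'\in[k-1]$, $j'\in[l-1]$: $t_{i',j'}\circ t_{i,j}$ equals $t_{i-1,j-1}\circ t_{i',j'}$ if $i'<i,j'<j$; $t_{i,j-1}\circ t_{i'+1,j'}$ if $i'\ge i,j'<j$; $t_{i-1,j}\circ t_{i',j'+1}$ if $i'<i,j'\ge j$; $t_{i,j}\circ t_{i'+1,j'+1}$ if $i'\ge i,j'\ge j$. (b) $t_{i,j}(\sigma\cdot p\cdot\tau)=\sigma_j\cdot t_{\tau(i),\sigma^{-1}(j)}(p)\cdot\tau_{\tau(i)}$, where for $\alpha\in\mathfrak S_n$ and $q\in[n]$, $\alpha_q\in\mathfrak S_{n-1}$ is the permutation whose word is obtained from the word $\alpha(1)\dots\alpha(n)$ by deleting the letter $q$ and subtracting $1$ from all letters $>q$. (c) for $p\in P(k,l)$, $p'\in P(k',l')$ ($k,l,k',l'\ge0$), $i\in[k+k']$, $j\in[l+l']$: $t_{i,j}(p*p')=t_{i,j}(p)*p'$ if $i\le k,j\le l$, and $t_{i,j}(p*p')=p*t_{i-k,j-l}(p')$ if $i>k,j>l$. The TRAP is unitary if there is $I\in P(1,1)$ such that for all $k,l\ge0$ and $p\in P(k,l)$: $t_{1,j}(I*p)=(1,2,\dots,j-1)\cdot p$ for $2\le j\le l+1$; $t_{i,1}(I*p)=p\cdot(1,2,\dots,i-1)^{-1}$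 for $2\le i\le k+1$; $t_{k+1,j}(p*I)=(j,j+1,\dots,l)^{-1}\cdot p$ for $1\le j\le l$; $t_{i,l+1}(p*I)=p\cdot(i,i+1,\dots,k)$ for $1\le i\le k$ (here $(a,\dots,b)$ denotes a cycle). The structure on $\mathrm{Hom}_V$. $V^*$ is the algebraic dual, $V^{\otimes 0}=\mathbb K$. $\mathfrak S_k$ acts on $V^{\otimes k}$ by $\sigma\cdot v_1\otimes\dots\otimes v_k=v_{\sigma^{-1}(1)}\otimes\dots\otimes v_{\sigma^{-1}(k)}$; for $f\in\mathrm{Hom}(V^{\otimes k},V^{\otimes l})$, $\tau\in\mathfrak S_l$, $\sigma\in\mathfrak S_k$, $(\tau\cdot f\cdot\sigma)(w)=\tau\cdot f(\sigma\cdot w)$. Horizontal concatenation is the tensor product of linear maps, with $I_0=1\in\mathbb K=\mathrm{Hom}(\mathbb K,\mathbb K)$. One identifies $(V^* )^{\otimes k}\otimes V^{\otimes l}$ with $\mathrm{Hom}(V^{\otimes k},V^{\otimes l})$ by the isomorphism $\theta_{k,l}(f_1\dots f_k\otimes v_1\dots v_l)(x_1\dots x_k)=f_1(x_1)\cdots f_k(x_k)\,v_1\dots v_l$, and $t_{i,j}$ is the linear map with $t_{i,j}(\theta_{k,l}(f_1\dots f_k\otimes v_1\dots v_l))=f_i(v_j)\,\theta_{k-1,l-1}(f_1\dots f_{i-1}f_{i+1}\dots f_k\otimes v_1\dots v_{j-1}v_{j+1}\dots v_l)$. *)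

(* Defs.v *)
From HB Require Import structures.
From mathcomp Require Import all_boot all_order all_fingroup all_algebra.
From mathcomp Require Import boolp.
From mathcomp Require Import freeg.
From mathcomp Require Import generic_quotient fintype.

Set Implicit Arguments.
Unset Strict Implicit.
Unset Printing Implicit Defensive.

Import GRing.Theory.
Local Open Scope ring_scope.
Local Open Scope quotient_scope.

(* The k-th tensor power of V is the free vector space on {ffun 'I_k -> V}
   modulo the span of the multilinearity relations.  It is shown below to be
   finite dimensional, so that Hom(V^{(x)k}, V^{(x)l}) is the library's
   'Hom(tpow V k, tpow V l). *)
Section TensorPowerDef.
Variables (K : fieldType) (V : vectType K) (k : nat).

Definition vupd (v : {ffun 'I_k -> V}) (i : 'I_k) (x : V) : {ffun 'I_k -> V} :=
  [ffun m => if m == i then x else v m].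

Definition multilinear (W : lmodType K) (mu : {ffun 'I_k -> V} -> W) : Prop :=
  forall v i a x y,
    mu (vupd v i (a *: x + y)) = a *: mu (vupd v i x) + mu (vupd v i y).

Definition freevec := {freeg {ffun 'I_k -> V} / K}.
HB.instance Definition _ := GRing.Lmodule.on freevec.

Definition gen (v : {ffun 'I_k -> V}) : freevec := Freeg [:: (1, v)].

Definition mrel (r : {ffun 'I_k -> V} * 'I_k * K * V * V) : freevec :=
  let: (v, i, a, x, y) := r in
  gen (vupd v i (a *: x + y)) - a *: gen (vupd v i x) - gen (vupd v i y).

Definition mrel_span : {pred freevec} := fun z =>
  `[< exists s : seq (K * ({ffun 'I_k -> V} * 'I_k * K * V * V)),
        z = \sum_(c <- s) c.1 *: mrel c.2 >].

Fact mrel_span_submod : submod_closed mrel_span.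
Proof.
split=> [|a u w /asboolP[s ->] /asboolP[t ->]].
  by apply/asboolP; exists [::]; rewrite big_nil.
apply/asboolP; exists ([seq (a * c.1, c.2) | c <- s] ++ t).
rewrite big_cat big_map scaler_sumr; congr (_ + _).
by apply: eq_bigr => c _; rewrite scalerA.
Qed.

HB.instance Definition _ :=
  GRing.isSubmodClosed.Build K freevec mrel_span mrel_span_submod.

Definition tpow := Quotient.quot mrel_span.
HB.instance Definition _ := GRing.Zmodule.on tpow.
HB.instance Definition _ := EqQuotient.on tpow.
HB.instance Definition _ : isZmodQuotient _ (Quotient.equiv mrel_span) 0 -%R +%R tpow :=
  ZmodQuotient.on (Quotient.quot mrel_span).

Let eqpi (x y : freevec) : (\pi_tpow x = \pi_tpow y) <-> (x - y \in mrel_span).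
Proof.
have E : (x - y \in mrel_span) = (\pi_tpow x == \pi_tpow y).
  exact: (Quotient.idealrBE mrel_span).
by rewrite E; split=> /eqP.
Qed.

Let piD (x y : freevec) : \pi_tpow (x + y) = \pi_tpow x + \pi_tpow y.
Proof. exact: (@pi_addr _ _ _ _ _ tpow). Qed.

Definition tscale (a : K) (q : tpow) : tpow := \pi_tpow (a *: repr q).

Let tscale_pi a x : tscale a (\pi_tpow x) = \pi_tpow (a *: x).
Proof.
rewrite /tscale eqpi -scalerBr; apply: rpredZ; rewrite -eqpi.
by rewrite reprK.
Qed.

Fact tscaleA a b q : tscale a (tscale b q) = tscale (a * b) q.
Proof. by rewrite -[q]reprK (tscale_pi b) (tscale_pi a) (tscale_pi (a * b)) scalerA. Qed.
Fact tscale1 : left_id 1 tscale.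
Proof. by move=> q; rewrite -[q]reprK tscale_pi scale1r. Qed.
Fact tscaleDr : right_distributive tscale +%R.
Proof.
move=> a p q; rewrite -[p]reprK -[q]reprK -piD (tscale_pi a (_ + _)).
by rewrite (tscale_pi a (repr p)) (tscale_pi a (repr q)) -piD scalerDr.
Qed.
Fact tscaleDl q : {morph tscale^~ q : a b / a + b}.
Proof.
move=> a b; rewrite -[q]reprK (tscale_pi a) (tscale_pi b) (tscale_pi (a + b)).
by rewrite -piD scalerDl.
Qed.

HB.instance Definition _ :=
  GRing.Zmodule_isLmodule.Build K tpow tscaleA tscale1 tscaleDr tscaleDl.

Let piZ a (x : freevec) : \pi_tpow (a *: x) = a *: (\pi_tpow x : tpow).
Proof. by rewrite -tscale_pi. Qed.

(* ten v is v_1 (x) ... (x) v_k. *)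
Definition ten (v : {ffun 'I_k -> V}) : tpow := \pi_tpow (gen v).

Lemma ten_multilinear : multilinear ten.
Proof.
move=> v i a x y; rewrite /ten -piZ -piD; apply/eqpi.
rewrite opprD addrA; apply/asboolP; exists [:: (1, (v, i, a, x, y))].
by rewrite big_seq1 scale1r.
Qed.

(* Linear extension of mu to the tensor power.  The value depends on the chosen
   representative of q unless mu is multilinear. *)
Definition tlift_fun (W : lmodType K) (mu : {ffun 'I_k -> V} -> W) (q : tpow) : W :=
  fglift mu (repr q).

Section Lift.
Variables (W : lmodType K) (mu : {ffun 'I_k -> V} -> W).
Hypothesis mu_ml : multilinear mu.

Let fgl_linear : linear (fglift mu : freevec -> W).
Proof.
have fglB (x y : freevec) : fglift mu (x - y) = fglift mu x - fglift mu y.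
  exact: lift_is_additive.
have fgl0 : fglift mu (0 : freevec) = 0 by rewrite -[0]subr0 fglB subrr.
have fglD (x y : freevec) : fglift mu (x + y) = fglift mu x + fglift mu y.
  by rewrite -[in LHS](opprK y) fglB -[- y]sub0r fglB fgl0 sub0r opprK.
have fgl_sum (s : seq {ffun 'I_k -> V}) (f : {ffun 'I_k -> V} -> freevec) :
    fglift mu (\sum_(z <- s) f z) = \sum_(z <- s) fglift mu (f z).
  exact: (big_morph (fglift mu : freevec -> W) fglD fgl0).
move=> a x y; rewrite fglD; congr (_ + _).
rewrite -[x in RHS]freeg_sumE -[a *: x]/(fgscale a x) /fgscale !fgl_sum scaler_sumr.
by apply: eq_bigr => z _; rewrite !liftU scalerA.
Qed.

Let fglL : {linear freevec -> W} := HB.pack (fglift mu : freevec -> W)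
  (GRing.isLinear.Build K freevec W _ (fglift mu : freevec -> W) fgl_linear).

Let tlift_pi x : tlift_fun mu (\pi_tpow x) = fglL x.
Proof.
apply/eqP; rewrite -subr_eq0 -[tlift_fun _ _]/(fglL (repr (\pi_tpow x))) -(linearB fglL).
have /asboolP[s ->] : repr (\pi_tpow x) - x \in mrel_span by rewrite -eqpi reprK.
rewrite (linear_sum fglL) big1 // => -[c [[[[v i] a] y] z]] _.
rewrite (linearZZ fglL) !(linearB fglL) (linearZZ fglL) /= /gen !liftU !scale1r mu_ml.
by rewrite addrAC addrK subrr scaler0.
Qed.

Lemma tlift_fun_linear : linear (tlift_fun mu).
Proof.
move=> a p q; rewrite -[p]reprK -[q]reprK -piZ -piD !tlift_pi.
exact: linearP.
Qed.

Lemma tlift_fun_ten v : tlift_fun mu (ten v) = mu v.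
Proof. by rewrite tlift_pi /= /gen liftU scale1r. Qed.

End Lift.

Lemma ten_span (q : tpow) :
  exists s : seq (K * {ffun 'I_k -> V}), q = \sum_(c <- s) c.1 *: ten c.2.
Proof.
exists [seq (coeff z (repr q), z) | z <- dom (repr q)].
rewrite big_map /= -[LHS]reprK -[repr q in LHS]freeg_sumE.
have pi0 : \pi_tpow (0 : freevec) = 0.
  by apply: (@addrI _ (\pi_tpow 0)); rewrite -piD !addr0.
rewrite (big_morph (\pi_tpow : freevec -> tpow) piD pi0).
apply: eq_bigr => z _; rewrite /ten -piZ; congr (\pi_tpow _).
apply/eqP/freeg_eqP => w.
by rewrite coeffZ !coeffU mul1r.
Qed.

End TensorPowerDef.

Section TensorPowerTheory.
Variables (K : fieldType) (V : vectType K) (k : nat).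
Implicit Types (v : {ffun 'I_k -> V}) (W : lmodType K).

Lemma vupd_same v i : vupd v i (v i) = v.
Proof. by apply/ffunP => m; rewrite ffunE; case: eqP => [->|]. Qed.

Lemma tpow_ext W (f g : tpow V k -> W) :
  linear f -> linear g -> (forall v, f (ten v) = g (ten v)) -> f =1 g.
Proof.
move=> fL gL efg q.
pose f' : {linear _ -> _} := HB.pack f (GRing.isLinear.Build K _ W _ f fL).
pose g' : {linear _ -> _} := HB.pack g (GRing.isLinear.Build K _ W _ g gL).
have [s ->] := ten_span q.
rewrite -[f _]/(f' _) -[g _]/(g' _) (linear_sum f') (linear_sum g').
by apply: eq_bigr => c _; rewrite (linearZZ f') (linearZZ g') /= efg.
Qed.

Lemma multilinear_sum W (I : finType) (mu : {ffun 'I_k -> V} -> W) v i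
    (c : I -> K) (x : I -> V) : multilinear mu ->
  mu (vupd v i (\sum_a c a *: x a)) = \sum_a c a *: mu (vupd v i (x a)).
Proof.
move=> mu_ml.
have mu0 : mu (vupd v i 0) = 0.
  have := mu_ml v i 1 0 0; rewrite !scale1r addr0.
  by move/eqP; rewrite -subr_eq subrr eq_sym => /eqP.
elim/big_rec2: _ => // a y w _ <-; exact: mu_ml.
Qed.

Let bV (a : 'I_(\dim {:V})) : V := (vbasis {:V})`_a.
Definition basis_tuple (a : {ffun 'I_k -> 'I_(\dim {:V})}) : {ffun 'I_k -> V} :=
  [ffun i => (vbasis {:V})`_(a i)].

Lemma multilinear_ext W (mu nu : {ffun 'I_k -> V} -> W) :
    multilinear mu -> multilinear nu ->
    (forall a, mu (basis_tuple a) = nu (basis_tuple a)) ->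
  mu =1 nu.
Proof.
move=> mu_ml nu_ml e v.
suff H j : (j <= k)%N -> forall v, (forall i : 'I_k, (j <= i)%N ->
    exists a, v i = bV a) -> mu v = nu v.
  by apply: (H k) => // i; rewrite leqNgt ltn_ord.
elim: j => [_|j IH ltjk] {}v hv.
  have [a ha] := fin_all_exists (fun i => hv i (leq0n i)).
  suff -> : v = basis_tuple [ffun i => a i] by [].
  by apply/ffunP => i; rewrite !ffunE ha.
pose i0 := Ordinal ltjk.
rewrite -(vupd_same v i0) (coord_vbasis (memvf (v i0))) !multilinear_sum //.
apply: eq_bigr => a _; congr (_ *: _); apply: IH => [|i leji]; first exact: ltnW.
rewrite ffunE; case: eqP => [_|ne]; first by exists a.
apply: hv; rewrite ltn_neqAle leji andbT.
by apply/eqP => ej; apply: ne; apply: val_inj.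
Qed.

Lemma multilinear_prod (f : 'I_k -> V -> K) :
    (forall i, linear (f i : V -> K^o)) ->
  multilinear (fun v => \prod_i f i (v i) : K^o).
Proof.
move=> fL v i a x y.
have upd_rest z : \prod_m f m (vupd v i z m) =
    f i z * \prod_(m | m != i) f m (v m).
  rewrite (bigD1 i) //= ffunE eqxx; congr (_ * _).
  by apply: eq_bigr => m /negbTE ne; rewrite ffunE ne.
rewrite !upd_rest (fL i a x y) mulrDl; congr (_ + _).
exact/esym/mulrA.
Qed.

Lemma multilinear_scale W (c : {ffun 'I_k -> V} -> K) (w : W) :
  multilinear (c : _ -> K^o) -> multilinear (fun v => c v *: w).
Proof. by move=> cL v i a x y; rewrite cL scalerDl scalerA. Qed.

Lemma multilinear_big W (I : finType) (mu : I -> {ffun 'I_k -> V} -> W) :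
  (forall a, multilinear (mu a)) -> multilinear (fun v => \sum_a mu a v).
Proof.
move=> muL v i a x y; rewrite scaler_sumr -big_split.
by apply: eq_bigr => b _; rewrite muL.
Qed.

Definition tcoord (a : {ffun 'I_k -> 'I_(\dim {:V})}) v : K^o :=
  \prod_i coord (vbasis {:V}) (a i) (v i).

Lemma tcoord_multilinear a : multilinear (tcoord a).
Proof.
exact: (multilinear_prod (f := fun i => coord (vbasis {:V}) (a i)))
  (fun i => @linearP _ _ _ _ (coord (vbasis {:V}) (a i))).
Qed.

Lemma tcoord_basis a b : tcoord a (basis_tuple b) = (a == b)%:R.
Proof.
have bfree : free (vbasis {:V}) := basis_free (vbasisP _).
rewrite /tcoord; have [->|ne] := eqVneq a b.
  by rewrite big1 // => i _; rewrite ffunE coord_free ?eqxx.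
have /existsP[i nei] : [exists i, a i != b i].
  apply: contraNT ne; rewrite negb_exists => /forallP h.
  by apply/eqP/ffunP => i; apply/eqP; move: (h i); rewrite negbK.
by rewrite (bigD1 i) //= ffunE coord_free // ?(negbTE nei) 1?eq_sym ?(negbTE nei) mul0r.
Qed.

Lemma multilinear_expand W (mu : {ffun 'I_k -> V} -> W) : multilinear mu ->
  forall v, mu v = \sum_a tcoord a v *: mu (basis_tuple a).
Proof.
move=> mu_ml; apply: multilinear_ext => // [|b].
  by apply: multilinear_big => a; apply/multilinear_scale/tcoord_multilinear.
rewrite (bigD1 b) //= big1 ?addr0 => [|a ne]; rewrite tcoord_basis.
  by rewrite eqxx scale1r.
by rewrite (negbTE ne) scale0r.
Qed.

Fact tpow_vect_iso : Vector.axiom #|{ffun 'I_k -> 'I_(\dim {:V})}| (tpow V k).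
Proof.
pose v2r (q : tpow V k) : 'rV[K]_#|{ffun 'I_k -> 'I_(\dim {:V})}| :=
  \row_c tlift_fun (tcoord (enum_val c)) q.
have v2rL : linear v2r.
  by move=> a p q; apply/rowP => c; rewrite !mxE tlift_fun_linear //; apply: tcoord_multilinear.
exists v2r => //.
pose r2v (r : 'rV[K]_#|{ffun 'I_k -> 'I_(\dim {:V})}|) : tpow V k :=
  \sum_c r 0 c *: ten (basis_tuple (enum_val c)).
have r2vL : linear r2v.
  move=> a p q; rewrite /r2v scaler_sumr -big_split; apply: eq_bigr => c _.
  by rewrite !mxE scalerDl scalerA.
exists r2v => [q|r].
  move: q; apply: (@tpow_ext _ (r2v \o v2r) id) => //.
    by move=> a p q /=; rewrite v2rL r2vL.
  move=> v /=; rewrite /r2v [RHS](multilinear_expand (@ten_multilinear _ _ _) v).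
  rewrite [RHS](reindex (@enum_val _ {ffun 'I_k -> 'I_(\dim {:V})})) /=; last first.
    exact/onW_bij/enum_val_bij.
  by apply: eq_bigr => c _; rewrite mxE tlift_fun_ten //; apply: tcoord_multilinear.
apply/rowP => c; rewrite mxE.
have cL := @tlift_fun_linear _ _ _ _ _ (@tcoord_multilinear (enum_val c)).
pose f : {linear _ -> _} := HB.pack (tlift_fun (tcoord (enum_val c)))
   (GRing.isLinear.Build K _ K^o _ _ cL).
rewrite -[tlift_fun _ _]/(f _) (linear_sum f).
have fE d : f (r 0 d *: ten (basis_tuple (enum_val d))) = r 0 d * (c == d)%:R.
  rewrite (linearZZ f) /= tlift_fun_ten; last exact: tcoord_multilinear.
  by rewrite tcoord_basis (inj_eq enum_val_inj).
under eq_bigr do rewrite fE.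
rewrite (bigD1 c) //= big1 => [|d ne]; first by rewrite eqxx mulr1 addr0.
by rewrite eq_sym (negbTE ne) mulr0.
Qed.

HB.instance Definition _ := Lmodule_hasFinDim.Build K (tpow V k) tpow_vect_iso.

End TensorPowerTheory.

Section TensorLift.
Variables (K : fieldType) (V : vectType K) (k : nat) (W : vectType K).
Implicit Types (mu : {ffun 'I_k -> V} -> W).

(* Meaningful only for multilinear mu, see tliftE. *)
Definition tlift mu : 'Hom(tpow V k, W) := linfun (tlift_fun mu).

Lemma tliftE mu : multilinear mu -> forall v, tlift mu (ten v) = mu v.
Proof.
move=> mu_ml v.
pose f : {linear tpow V k -> W} := HB.pack (tlift_fun mu)
  (GRing.isLinear.Build K (tpow V k) W _ (tlift_fun mu) (tlift_fun_linear mu_ml)).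
by rewrite /tlift -[linfun _]/(linfun f) lfunE /= tlift_fun_ten.
Qed.

Lemma hom_tpowP (f g : 'Hom(tpow V k, W)) : (forall v, f (ten v) = g (ten v)) <-> f = g.
Proof.
split=> [efg|-> //]; apply/lfunP/tpow_ext => //; exact: linearP.
Qed.

Theorem tpow_universal mu : multilinear mu ->
  exists! f : 'Hom(tpow V k, W), forall v, f (ten v) = mu v.
Proof.
move=> mu_ml; exists (tlift mu); split=> [|f fE]; first exact: tliftE.
by apply/hom_tpowP => v; rewrite fE tliftE.
Qed.

End TensorLift.

Section HomStructure.
Variables (K : fieldType) (V : vectType K).

Local Notation homT k l := 'Hom(tpow V k, tpow V l).

(* s . (v_1 (x) ... (x) v_k) = v_{s^-1(1)} (x) ... (x) v_{s^-1(k)} *)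
Definition tperm_fun k (s : 'S_k) : 'End(tpow V k) :=
  tlift (fun v => ten [ffun i => v ((s^-1)%g i)]).

Lemma tperm_funE k (s : 'S_k) v :
  tperm_fun s (ten v) = ten [ffun i => v ((s^-1)%g i)].
Proof.
rewrite tliftE // => {}v i a x y.
have E z : [ffun m => vupd v i z ((s^-1)%g m)] =
    vupd [ffun m => v ((s^-1)%g m)] (s i) z.
  by apply/ffunP => m; rewrite !ffunE (can2_eq (permKV s) (permK s)).
by rewrite !E ten_multilinear.
Qed.

Definition vcat (T : Type) m n (v : {ffun 'I_m -> T}) (w : {ffun 'I_n -> T}) :
    {ffun 'I_(m + n) -> T} :=
  [ffun i => match split i with inl a => v a | inr b => w b end].

Lemma vcat_updl m n (v : {ffun 'I_m -> V}) (w : {ffun 'I_n -> V}) i z :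
  vcat (vupd v i z) w = vupd (vcat v w) (lshift n i) z.
Proof.
apply/ffunP => a; rewrite !ffunE; case: split_ordP => b ->; rewrite ?ffunE.
  by rewrite eq_lshift.
by rewrite eq_rlshift.
Qed.

Lemma vcat_updr m n (v : {ffun 'I_m -> V}) (w : {ffun 'I_n -> V}) i z :
  vcat v (vupd w i z) = vupd (vcat v w) (rshift m i) z.
Proof.
apply/ffunP => a; rewrite !ffunE; case: split_ordP => b ->; rewrite ?ffunE.
  by rewrite eq_lrshift.
by rewrite eq_rshift.
Qed.

(* The identification V^{(x)m} x V^{(x)n} -> V^{(x)(m+n)}, as a bilinear map. *)
Definition juxt m n : 'Hom(tpow V m, 'Hom(tpow V n, tpow V (m + n))) :=
  tlift (fun v => tlift (fun w => ten (vcat v w))).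

Lemma juxtE m n (v : {ffun 'I_m -> V}) (w : {ffun 'I_n -> V}) :
  juxt m n (ten v) (ten w) = ten (vcat v w).
Proof.
have ml2 (u : {ffun 'I_m -> V}) : multilinear (fun w : {ffun 'I_n -> V} => ten (vcat u w)).
  by move=> ? i a x y; rewrite !vcat_updr ten_multilinear.
rewrite tliftE ?tliftE // => u i a x y.
apply/hom_tpowP => w'; rewrite !lfunE /= !lfunE /= !tliftE //.
by rewrite !vcat_updl ten_multilinear.
Qed.

(* The tensor product of linear maps:
   x_1 ... x_{k+k'} |-> f (x_1 ... x_k) (x) g (x_{k+1} ... x_{k+k'}). *)
Definition hcat_hom k l k' l' (f : homT k l) (g : homT k' l') :
    homT (k + k') (l + l') :=
  tlift (fun x => juxt l l' (f (ten [ffun i => x (lshift k' i)]))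
                            (g (ten [ffun i => x (rshift k i)]))).

Lemma hcat_homE k l k' l' (f : homT k l) (g : homT k' l') x :
  hcat_hom f g (ten x) =
  juxt l l' (f (ten [ffun i => x (lshift k' i)])) (g (ten [ffun i => x (rshift k i)])).
Proof.
rewrite tliftE // => {}x i a y z.
case: (split_ordP i) => j ->.
  have E u : [ffun m => vupd x (lshift k' j) u (lshift k' m)] =
      vupd [ffun m => x (lshift k' m)] j u.
    by apply/ffunP => m; rewrite !ffunE eq_lshift.
  have E' u : [ffun m => vupd x (lshift k' j) u (rshift k m)] =
      [ffun m => x (rshift k m)].
    by apply/ffunP => m; rewrite !ffunE eq_rlshift.
  by rewrite !E !E' ten_multilinear !linearP /= !lfunE /= !lfunE.
have E u : [ffun m => vupd x (rshift k j) u (rshift k m)] =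
    vupd [ffun m => x (rshift k m)] j u.
  by apply/ffunP => m; rewrite !ffunE eq_rshift.
have E' u : [ffun m => vupd x (rshift k j) u (lshift k' m)] =
    [ffun m => x (lshift k' m)].
  by apply/ffunP => m; rewrite !ffunE eq_lrshift.
by rewrite !E !E' ten_multilinear !linearP.
Qed.

Definition dual := 'Hom(V, K^o).

(* theta(f_1 ... f_k (x) v_1 ... v_l)(x_1 ... x_k) = f_1(x_1) ... f_k(x_k) v_1 ... v_l *)
Definition theta k l (f : {ffun 'I_k -> dual}) (v : {ffun 'I_l -> V}) : homT k l :=
  tlift (fun x => (\prod_i f i (x i) : K) *: ten v).

Lemma thetaE k l (f : {ffun 'I_k -> dual}) (v : {ffun 'I_l -> V}) x :
  theta f v (ten x) = (\prod_i f i (x i) : K) *: ten v.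
Proof.
rewrite tliftE //; apply: multilinear_scale.
by apply: (multilinear_prod (f := fun i => f i)) => i; exact: linearP.
Qed.

Definition vdel (T : Type) n (i : 'I_n.+1) (v : {ffun 'I_n.+1 -> T}) : {ffun 'I_n -> T} :=
  [ffun m => v (lift i m)].

(* t(theta(f_1 ... f_k (x) v_1 ... v_l)) = f_i(v_j) theta(f (x) v with the i-th
   form and the j-th vector removed), for linear t. *)
Definition is_ptrace k l (i : 'I_k.+1) (j : 'I_l.+1)
    (t : 'Hom(homT k.+1 l.+1, homT k l)) : Prop :=
  forall f v, t (theta f v) = (f i (v j) : K) *: theta (vdel i f) (vdel j v).

Definition dbasis k (a : {ffun 'I_k -> 'I_(\dim {:V})}) : {ffun 'I_k -> dual} :=
  [ffun i => linfun (coord (vbasis {:V}) (a i) : V -> K^o)].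

Lemma theta_dbasisE k l (a : {ffun 'I_k -> 'I_(\dim {:V})}) (v : {ffun 'I_l -> V}) x :
  theta (dbasis a) v (ten x) = (tcoord a x : K) *: ten v.
Proof.
by rewrite thetaE; congr (_ *: _); apply: eq_bigr => i _; rewrite ffunE lfunE.
Qed.

Lemma theta_span k l (F : homT k l) :
  exists c : {ffun 'I_k -> 'I_(\dim {:V})} -> {ffun 'I_l -> 'I_(\dim {:V})} -> K,
    F = \sum_a \sum_b c a b *: theta (dbasis a) (basis_tuple b).
Proof.
exists (fun a b => tlift (tcoord b) (F (ten (basis_tuple a)))).
have tE (w : tpow V l) : w = \sum_b (tlift (tcoord b) w : K) *: ten (basis_tuple b).
  move: w; apply: (@tpow_ext _ _ _ _ id) => // [a p q|v].
    rewrite scaler_sumr -big_split; apply: eq_bigr => b _ /=.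
    by rewrite linearP scalerDl scalerA.
  rewrite [LHS](multilinear_expand (@ten_multilinear _ _ _)).
  by apply: eq_bigr => b _; rewrite tliftE //; apply: tcoord_multilinear.
apply/hom_tpowP => x; rewrite sum_lfunE.
have Fml : multilinear (fun x => F (ten x)).
  by move=> v i a y z; rewrite ten_multilinear linearP.
rewrite (multilinear_expand Fml); apply: eq_bigr => a _.
rewrite sum_lfunE [in LHS](tE (F _)) scaler_sumr; apply: eq_bigr => b _.
by rewrite lfunE /= theta_dbasisE !scalerA mulrC.
Qed.

Let vins n (i : 'I_n.+1) (y : V) (x : {ffun 'I_n -> V}) : {ffun 'I_n.+1 -> V} :=
  [ffun m => if unlift i m is Some m' then x m' else y].

Let ins n (i : 'I_n.+1) (y : V) : 'Hom(tpow V n, tpow V n.+1) :=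
  tlift (fun x => ten (vins i y x)).

Let insE n (i : 'I_n.+1) (y : V) x : ins i y (ten x) = ten (vins i y x).
Proof.
rewrite tliftE // => {}x j a z w.
have E u : vins i y (vupd x j u) = vupd (vins i y x) (lift i j) u.
  apply/ffunP => m; rewrite !ffunE; case: unliftP => [m'|] ->.
    by rewrite ffunE (inj_eq lift_inj).
  by rewrite (negbTE (neq_lift _ _)).
by rewrite !E ten_multilinear.
Qed.

Let contr n (j : 'I_n.+1) (a : 'I_(\dim {:V})) : 'Hom(tpow V n.+1, tpow V n) :=
  tlift (fun v => coord (vbasis {:V}) a (v j) *: ten (vdel j v)).

Let contrE n (j : 'I_n.+1) a v :
  contr j a (ten v) = coord (vbasis {:V}) a (v j) *: ten (vdel j v).
Proof.
rewrite tliftE // => {}v i c z w.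
case: (unliftP j i) => [i' ->|->].
  have E u : vdel j (vupd v (lift j i') u) = vupd (vdel j v) i' u.
    by apply/ffunP => m; rewrite !ffunE (inj_eq lift_inj).
  rewrite !E !ffunE (negbTE (neq_lift _ _)) ten_multilinear.
  by rewrite scalerDr !scalerA [c * _]mulrC.
have E u : vdel j (vupd v j u) = vdel j v.
  by apply/ffunP => m; rewrite !ffunE eq_sym (negbTE (neq_lift _ _)).
by rewrite !E !ffunE eqxx linearP scalerDl scalerA.
Qed.

Theorem ptrace_exists_unique k l (i : 'I_k.+1) (j : 'I_l.+1) :
  exists! t, is_ptrace i j t.
Proof.
pose tf (F : homT k.+1 l.+1) : homT k l :=
  \sum_a (contr j a \o F \o ins i (vbasis {:V})`_a)%VF.
have tfL : linear tf.
  move=> c F G; rewrite /tf scaler_sumr -big_split; apply: eq_bigr => a _ /=.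
  apply/lfunP => x; rewrite add_lfunE scale_lfunE !comp_lfunE add_lfunE scale_lfunE.
  by rewrite linearP.
pose t : {linear _ -> _} := HB.pack tf (GRing.isLinear.Build K _ _ _ tf tfL).
have t_tr : is_ptrace i j (linfun t).
  move=> f v.
  rewrite lfunE /= /tf; apply/hom_tpowP => x.
  rewrite sum_lfunE lfunE /= thetaE.
  transitivity (\sum_(a < \dim {:V}) ((f i (vbasis {:V})`_a : K) * coord (vbasis {:V}) a (v j)) *:
     ((\prod_m vdel i f m (x m) : K) *: ten (vdel j v))).
    apply: eq_bigr => a _; rewrite !comp_lfunE insE thetaE linearZZ /= contrE.
    rewrite !scalerA; congr (_ *: _).
    rewrite (bigD1_ord i) //= ffunE unlift_none mulrAC; congr (_ * _).
    by apply: eq_bigr => m _; rewrite !ffunE liftK.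
  rewrite -scaler_suml; congr (_ *: _).
  rewrite [v j in RHS](coord_vbasis (memvf (v j))) linear_sum.
  by apply: eq_bigr => a _; rewrite linearZZ mulrC.
exists (linfun t); split=> // u u_tr.
apply/lfunP => F; have [c ->] := theta_span F.
rewrite !linear_sum; apply: eq_bigr => a _.
rewrite !linear_sum; apply: eq_bigr => b _.
by rewrite !linearZZ /= u_tr t_tr.
Qed.

(* The unique linear map with that property. *)
Definition ptrace k l (i : 'I_k.+1) (j : 'I_l.+1) :
    'Hom('Hom(tpow V k.+1, tpow V l.+1), 'Hom(tpow V k, tpow V l)) :=
  projT1 (cid (ptrace_exists_unique i j)).

Lemma ptraceP k l (i : 'I_k.+1) (j : 'I_l.+1) : is_ptrace i j (ptrace i j).
Proof. by rewrite /ptrace; case: cid => t []. Qed.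

End HomStructure.

Section TpowLow.
Variables (K : fieldType) (V : vectType K).

Lemma tpow0_scalars : bijective (fun c : K => c *: ten [ffun i : 'I_0 => 0 : V]).
Proof.
have nu_ml : multilinear (fun _ : {ffun 'I_0 -> V} => 1 : K^o) by move=> v [].
exists (tlift (fun _ : {ffun 'I_0 -> V} => 1 : K^o)) => [c|].
  by rewrite linearZZ /= tliftE //; apply: mulr1.
apply: (@tpow_ext _ _ _ _ _ id) => // [a p q|v].
  by rewrite linearP scalerDl scalerA.
by rewrite tliftE // scale1r; congr ten; apply/ffunP => -[].
Qed.

Lemma tpow1_vectors :
  linear (fun x : V => ten [ffun _ : 'I_1 => x]) /\
  bijective (fun x : V => ten [ffun _ : 'I_1 => x]).
Proof.
have updE (x y : V) : [ffun _ : 'I_1 => x] = vupd [ffun _ => y] ord0 x.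
  by apply/ffunP => i; rewrite !ffunE ord1.
have jL : linear (fun x : V => ten [ffun _ : 'I_1 => x]).
  by move=> a x y; rewrite (updE (a *: x + y) 0) ten_multilinear -!updE.
have nu_ml : multilinear (fun v : {ffun 'I_1 -> V} => v ord0).
  by move=> v i a x y; rewrite !ffunE ord1.
split=> //; exists (tlift (fun v : {ffun 'I_1 -> V} => v ord0)) => [x|].
  by rewrite tliftE // ffunE.
apply: (@tpow_ext _ _ _ _ _ id) => // [a p q|v]; first by rewrite linearP jL.
by rewrite tliftE //; congr ten; apply/ffunP => i; rewrite ffunE ord1.
Qed.

End TpowLow.

Section Permutations.
Local Open Scope nat_scope.

(* Letters and positions are numbered from 0 (elements of 'I_n).  The group law
   of 'S_n is (s * t) i = t (s i), so the usual composite s o t is (t * s)%g. *)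

Definition otimes_fun m n (s : 'S_m) (t : 'S_n) (i : 'I_(m + n)) : 'I_(m + n) :=
  match split i with inl a => lshift n (s a) | inr b => rshift m (t b) end.

Fact otimes_inj m n (s : 'S_m) (t : 'S_n) : injective (otimes_fun s t).
Proof.
apply: (can_inj (g := otimes_fun s^-1 t^-1)) => i; rewrite /otimes_fun.
case: (split_ordP i) => a ->.
  by rewrite (unsplitK (inl _)) permK.
by rewrite (unsplitK (inr _)) permK.
Qed.

Definition otimes m n (s : 'S_m) (t : 'S_n) : 'S_(m + n) := perm (@otimes_inj m n s t).

(* i |-> i + n if i < m, and i |-> i - m otherwise *)
Definition cblock_fun m n (i : 'I_(m + n)) : 'I_(m + n) :=
  cast_ord (addnC n m)
    match split i with inl a => rshift n a | inr b => lshift m b end.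

Fact cblock_inj m n : injective (@cblock_fun m n).
Proof.
move=> i j /cast_ord_inj.
case: (split_ordP i) => a ->; case: (split_ordP j) => b -> /eqP.
- by rewrite eq_rshift => /eqP ->.
- by rewrite eq_rlshift.
- by rewrite eq_lrshift.
- by rewrite eq_lshift => /eqP ->.
Qed.

Definition cblock m n : 'S_(m + n) := perm (@cblock_inj m n).

(* The permutation s_q: in the word of s delete the letter q, found at position
   s^-1(q), and standardize; see pdel_word. *)
Definition pdel_fun n (s : 'S_n.+1) (q : 'I_n.+1) (i : 'I_n) : 'I_n :=
  odflt i (unlift q (s (lift ((s^-1)%g q) i))).

Lemma lift_pdel_fun n (s : 'S_n.+1) (q : 'I_n.+1) (i : 'I_n) :
  lift q (pdel_fun s q i) = s (lift ((s^-1)%g q) i).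
Proof.
rewrite /pdel_fun; case: unliftP => [j -> //|] /eqP.
by rewrite -{2}[q](permKV s) (inj_eq perm_inj) eq_sym (negbTE (neq_lift _ _)).
Qed.

Fact pdel_inj n (s : 'S_n.+1) (q : 'I_n.+1) : injective (pdel_fun s q).
Proof.
move=> i j /(congr1 (lift q)); rewrite !lift_pdel_fun => /perm_inj.
exact: lift_inj.
Qed.

Definition pdel n (s : 'S_n.+1) (q : 'I_n.+1) : 'S_n := perm (@pdel_inj n s q).

Lemma pdel_word n (s : 'S_n.+1) (q : 'I_n.+1) :
  [seq val (pdel s q i) | i <- enum 'I_n] =
  [seq unbump q m | m <- rem (val q) [seq val (s i) | i <- enum 'I_n.+1]].
Proof.
have us : uniq [seq val (s i) | i <- enum 'I_n.+1].
  by rewrite map_inj_uniq ?enum_uniq // => i j /val_inj/perm_inj.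
rewrite rem_filter // filter_map -!map_comp.
have -> : [seq i <- enum 'I_n.+1 | preim (fun i => val (s i)) (predC1 (val q)) i] =
          [seq lift ((s^-1)%g q) i | i <- enum 'I_n].
  have enum_sorted m : sorted (relpre val ltn) (enum 'I_m).
    by rewrite -sorted_map val_enum_ord iota_ltn_sorted.
  apply: (irr_sorted_eq (leT := relpre val ltn)).
  - by move=> x y z; apply: ltn_trans.
  - by move=> x /=; rewrite ltnn.
  - by apply: sorted_filter => [x y z|]; [apply: ltn_trans | apply: enum_sorted].
  - rewrite sorted_map; apply: sub_sorted (enum_sorted n) => x y /=.
    by rewrite !ltnNge leq_bump2.
  move=> x; rewrite mem_filter mem_enum andbT /= val_eqE.
  rewrite -(inj_eq (@perm_inj _ s^-1)) permK.
  case: (unliftP ((s^-1)%g q) x) => [y ->|->].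
    by rewrite eq_sym neq_lift map_f ?mem_enum.
  rewrite eqxx; apply/esym/negbTE/negP => /mapP[y _ /eqP].
  by rewrite (negbTE (neq_lift _ _)).
rewrite -!map_comp; apply: eq_map => i /=.
by rewrite -lift_pdel_fun permE /= bumpK.
Qed.

(* The cycle (a, a + 1, ..., b). *)
Definition pcycle n (a b : nat) : 'S_n :=
  perm (can_inj (prev_next
    (filter_uniq (fun i : 'I_n => a <= i <= b) (enum_uniq 'I_n)))).

Lemma pcycleE n a b (i : 'I_n) : (a <= b < n)%N ->
  val (pcycle n a b i) =
  if (a <= i < b)%N then i.+1 else if i == b :> nat then a else i.
Proof.
case/andP=> leab ltbn; rewrite permE.
set c := [seq _ <- _ | _].
have vc : map val c = iota a (b - a).+1.
  apply: (irr_sorted_eq ltn_trans ltnn); last 1 first.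
  - move=> m; rewrite mem_iota addnS subnKC // ltnS.
    apply/mapP/idP => [[x]|lem]; first by rewrite mem_filter => /andP[? _] ->.
    have ltmn : (m < n)%N by case/andP: lem => _ /leq_ltn_trans; apply.
    by exists (Ordinal ltmn); rewrite // mem_filter lem mem_enum.
  - rewrite sorted_map; apply: sorted_filter => [x y z|]; first exact: ltn_trans.
    by rewrite -sorted_map val_enum_ord iota_ltn_sorted.
  - exact: iota_ltn_sorted.
have -> : val (next c i) = next (map val c) (val i).
  by rewrite (next_map val_inj (filter_uniq _ (enum_uniq _))).
rewrite vc next_nth mem_iota addnS subnKC // ltnS /=.
have [leai /=|ltia /=] := leqP a i; last by rewrite ltn_eqF // (leq_trans ltia).
case: ltngtP => [ltib|ltbi|->] //=.
- have [<-|neai] := eqVneq a i.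
    by rewrite nth_iota ?subn_gt0 // ?addn0 // (leq_ltn_trans leai ltib).
  have ltai : (a < i)%N by rewrite ltn_neqAle neai.
  have -> : index (val i) (iota a.+1 (b - a)) = (i - a.+1)%N.
    have {1}-> : val i = nth 0%N (iota a.+1 (b - a)) (i - a.+1).
      by rewrite nth_iota ?subnKC // subnSK // leq_sub2r // ltnW.
    rewrite index_uniq ?iota_uniq // size_iota subnSK // leq_sub2r //.
    exact: ltnW.
  rewrite /= nth_iota; last by rewrite subnSK // ltn_sub2r // (ltn_trans ltai).
  by rewrite subnSK // addSn subnKC.
- have [<-|neab] := eqVneq a b.
    by rewrite subnn.
  have ltab : (a < b)%N by rewrite ltn_neqAle neab.
  have -> : index (b : nat) (iota a.+1 (b - a)) = (b - a.+1)%N.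
    have {1}-> : b = nth 0%N (iota a.+1 (b - a)) (b - a.+1).
      by rewrite nth_iota ?subnKC // subnSK // leq_sub2r.
    by rewrite index_uniq ?iota_uniq // size_iota subnSK.
  by rewrite /= nth_default // size_iota subnSK.
Qed.

End Permutations.

Local Open Scope ring_scope.

(* tptr is indexed so that P(k+1, l+1) is sent to P(k, l). *)
Record trap_data := TrapData {
  tset : nat -> nat -> Type;
  tlact : forall k l, 'S_l -> tset k l -> tset k l;
  tract : forall k l, tset k l -> 'S_k -> tset k l;
  thcat : forall k l k' l', tset k l -> tset k' l' -> tset (k + k')%N (l + l')%N;
  tunit0 : tset 0 0;
  tptr : forall k l, 'I_k.+1 -> 'I_l.+1 -> tset k.+1 l.+1 -> tset k l
}.

Arguments tlact {t k l} s p.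
Arguments tract {t k l} p s.
Arguments thcat {t k l k' l'} p p'.
Arguments tunit0 {t}.
Arguments tptr {t k l} i j p.

Definition tcast (P : trap_data) k k' l l' (ek : k = k') (el : l = l')
    (p : tset P k l) : tset P k' l' :=
  match ek in _ = a, el in _ = b return tset P a b with erefl, erefl => p end.

(* In the rules for iterated traces inord only retypes indices that are in
   range.  The last two fields cover the indices i <= k, j <= l (lshift) and
   i > k, j > l (rshift) of t_{i,j}(p * p'). *)
Record is_trap (P : trap_data) : Prop := IsTrap {
  trap_lact1 : forall k l (p : tset P k l), tlact 1%g p = p;
  trap_lactM : forall k l (s s' : 'S_l) (p : tset P k l),
    tlact s (tlact s' p) = tlact (s' * s)%g p;
  trap_ract1 : forall k l (p : tset P k l), tract p 1%g = p;
  trap_ractM : forall k l (s s' : 'S_k) (p : tset P k l),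
    tract (tract p s) s' = tract p (s' * s)%g;
  trap_actC : forall k l (s : 'S_l) (t : 'S_k) (p : tset P k l),
    tract (tlact s p) t = tlact s (tract p t);

  trap_hcatA : forall k l k' l' k'' l''
      (p : tset P k l) (p' : tset P k' l') (p'' : tset P k'' l''),
    tcast (addnA k k' k'') (addnA l l' l'') (thcat p (thcat p' p'')) =
    thcat (thcat p p') p'';
  trap_hcat0p : forall k l (p : tset P k l), thcat tunit0 p = p;
  trap_hcatp0 : forall k l (p : tset P k l),
    tcast (addn0 k) (addn0 l) (thcat p tunit0) = p;
  trap_hcat_act : forall k l k' l' (p : tset P k l) (p' : tset P k' l')
      (s : 'S_l) (t : 'S_k) (s' : 'S_l') (t' : 'S_k'),
    thcat (tract (tlact s p) t) (tract (tlact s' p') t') =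
    tract (tlact (otimes s s') (thcat p p')) (otimes t t');
  trap_hcatC : forall k l k' l' (p : tset P k l) (p' : tset P k' l'),
    tlact (cblock l l') (thcat p p') =
    tract (tcast (addnC k' k) (addnC l' l) (thcat p' p)) (cblock k k');

  trap_ptr_ltlt : forall k l (p : tset P k.+2 l.+2)
      (i : 'I_k.+2) (j : 'I_l.+2) (i' : 'I_k.+1) (j' : 'I_l.+1),
    (i' < i)%N -> (j' < j)%N ->
    tptr i' j' (tptr i j p) =
    tptr (inord i.-1) (inord j.-1) (tptr (inord i') (inord j') p);
  trap_ptr_gelt : forall k l (p : tset P k.+2 l.+2)
      (i : 'I_k.+2) (j : 'I_l.+2) (i' : 'I_k.+1) (j' : 'I_l.+1),
    (i <= i')%N -> (j' < j)%N ->
    tptr i' j' (tptr i j p) =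
    tptr (inord i) (inord j.-1) (tptr (inord i'.+1) (inord j') p);
  trap_ptr_ltge : forall k l (p : tset P k.+2 l.+2)
      (i : 'I_k.+2) (j : 'I_l.+2) (i' : 'I_k.+1) (j' : 'I_l.+1),
    (i' < i)%N -> (j <= j')%N ->
    tptr i' j' (tptr i j p) =
    tptr (inord i.-1) (inord j) (tptr (inord i') (inord j'.+1) p);
  trap_ptr_gege : forall k l (p : tset P k.+2 l.+2)
      (i : 'I_k.+2) (j : 'I_l.+2) (i' : 'I_k.+1) (j' : 'I_l.+1),
    (i <= i')%N -> (j <= j')%N ->
    tptr i' j' (tptr i j p) =
    tptr (inord i) (inord j) (tptr (inord i'.+1) (inord j'.+1) p);

  trap_ptr_act : forall k l (p : tset P k.+1 l.+1) (s : 'S_l.+1) (t : 'S_k.+1)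
      (i : 'I_k.+1) (j : 'I_l.+1),
    tptr i j (tract (tlact s p) t) =
    tract (tlact (pdel s j) (tptr (t i) ((s^-1)%g j) p)) (pdel t (t i));

  trap_ptr_hcatl : forall k l k' l' (p : tset P k.+1 l.+1) (p' : tset P k' l')
      (i : 'I_k.+1) (j : 'I_l.+1),
    @tptr P (k + k')%N (l + l')%N (lshift k' i) (lshift l' j) (thcat p p') =
    thcat (tptr i j p) p';
  trap_ptr_hcatr : forall k l k' l' (p : tset P k l) (p' : tset P k'.+1 l'.+1)
      (i : 'I_k'.+1) (j : 'I_l'.+1),
    tptr (cast_ord (addnS k k') (rshift k i)) (cast_ord (addnS l l') (rshift l j))
      (tcast (addnS k k') (addnS l l') (thcat p p')) =
    thcat p (tptr i j p')
}.

(* With 0-based indices the 1-based cycles (1 ... j-1), (1 ... i-1),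
   (j ... l), (i ... k) are pcycle 0 j.-1, pcycle 0 i.-1, pcycle j l.-1,
   pcycle i k.-1. *)
Record is_trap_unit (P : trap_data) (I : tset P 1 1) : Prop := IsTrapUnit {
  trap_unit_ll : forall k l (p : tset P k l) (j : 'I_l.+1), (0 < j)%N ->
    @tptr P k l ord0 j (thcat I p) = tlact (pcycle l 0 j.-1) p;
  trap_unit_lr : forall k l (p : tset P k l) (i : 'I_k.+1), (0 < i)%N ->
    @tptr P k l i ord0 (thcat I p) = tract p (pcycle k 0 i.-1)^-1%g;
  trap_unit_rl : forall k l (p : tset P k l) (j : 'I_l.+1), (j < l)%N ->
    tptr ord_max j (tcast (addn1 k) (addn1 l) (thcat p I)) =
    tlact (pcycle l j l.-1)^-1%g p;
  trap_unit_rr : forall k l (p : tset P k l) (i : 'I_k.+1), (i < k)%N ->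
    tptr i ord_max (tcast (addn1 k) (addn1 l) (thcat p I)) =
    tract p (pcycle k i k.-1)
}.

Definition is_wheeled_prop (P : trap_data) : Prop :=
  is_trap P /\ exists I : tset P 1 1, is_trap_unit I.

Section HomTrap.
Variables (K : fieldType) (V : vectType K).

Definition hom_trap : trap_data := {|
  tset k l := 'Hom(tpow V k, tpow V l);
  tlact k l s f := (tperm_fun V s \o f)%VF;
  tract k l f s := (f \o tperm_fun V s)%VF;
  thcat k l k' l' f g := hcat_hom f g;
  tunit0 := \1%VF;
  tptr k l i j f := ptrace V i j f
|}.

(* Id_V, through the identification of V with tpow V 1 (tpow1_vectors); likewise
   tunit0 is 1 in K = Hom(K, K), with K identified with tpow V 0
   (tpow0_scalars). *)
Definition hom_trap_unit : tset hom_trap 1 1 := \1%VF.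

End HomTrap.

(* Main.v *)
Require Import Defs.
From HB Require Import structures.
From mathcomp Require Import all_boot all_fingroup all_algebra.
From mathcomp Require Import zify.

(** Every linear map between tensor powers of a finite dimensional space V is a
    linear combination of the rank-one maps theta f v, with f a word of linear
    forms and v a word of vectors.  All the operations of the structure are
    linear in each argument, so identities between them have to be checked on
    rank-one maps only ([theta_ext]), and there each operation acts on the words
    alone:
    permutations permute the letters ([tperm_theta], [theta_tperm]), horizontal
    concatenation concatenates the two pairs of words ([hcat_theta]), and a
    partial trace deletes one letter of f and one letter of v and multiplies by
    the value of the deleted form at the deleted vector ([ptrace_theta]).  The
    axioms on concatenation and traces thus become combinatorial identities about
    deleting, permuting and concatenating the letters of a word; the axioms on
    the actions alone are properties of the composition of maps.

    The unit axioms need one more ingredient.  The identity of V is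
    the sum of the e^a (x) e_a over a basis e_a with dual basis e^a
    ([id1_theta]), and summing over a the value of one of these at a letter of a
    word times the word with that letter replaced by the other restores the word
    ([contract_vectors], [contract_forms]).  The remaining effect
    of tracing Id_V * p across the unit is that the contracted letter
    has moved to the end of the word where Id_V was added, that is, a
    cycle has acted ([vdel_cons_rotate], [vdel_rcons_rotate]). *)

Set Implicit Arguments.
Unset Strict Implicit.
Unset Printing Implicit Defensive.

Import GRing.Theory.
Local Open Scope ring_scope.

(** * Deleting, permuting and concatenating the letters of a word *)

Section Words.
Variable T : Type.

(** The index i is only required to have the right value, so that it may come
    with any casts between equal dimensions. *)
Lemma vcatL m n (v : {ffun 'I_m -> T}) (w : {ffun 'I_n -> T}) (i : 'I_(m + n)) (a : 'I_m) :
  i = a :> nat -> vcat v w i = v a.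
Proof.
move=> e; have -> : i = lshift n a by apply: val_inj.
by rewrite ffunE (unsplitK (inl a)).
Qed.

Lemma vcatR m n (v : {ffun 'I_m -> T}) (w : {ffun 'I_n -> T}) (i : 'I_(m + n)) (b : 'I_n) :
  i = (m + b)%N :> nat -> vcat v w i = w b.
Proof.
move=> e; have -> : i = rshift m b by apply: val_inj.
by rewrite ffunE (unsplitK (inr b)).
Qed.

Definition vcast k k' (e : k = k') (v : {ffun 'I_k -> T}) : {ffun 'I_k' -> T} :=
  [ffun i => v (cast_ord (esym e) i)].

(** Both actions on Hom have this form: s acts on the right by [vact s] on the
    forms, and on the left by [vact s^-1] on the vectors. *)
Definition vact k (s : 'S_k) (v : {ffun 'I_k -> T}) : {ffun 'I_k -> T} :=
  [ffun i => v (s i)].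

Lemma vcastE k k' (e : k = k') (v : {ffun 'I_k -> T}) i :
  vcast e v i = v (cast_ord (esym e) i).
Proof. exact: ffunE. Qed.

Lemma vactE k (s : 'S_k) (v : {ffun 'I_k -> T}) i : vact s v i = v (s i).
Proof. exact: ffunE. Qed.

Lemma vdelE k j (v : {ffun 'I_k.+1 -> T}) i : vdel j v i = v (lift j i).
Proof. exact: ffunE. Qed.

Lemma vcatA m n p (v : {ffun 'I_m -> T}) (w : {ffun 'I_n -> T}) (u : {ffun 'I_p -> T}) :
  vcast (addnA m n p) (vcat v (vcat w u)) = vcat (vcat v w) u.
Proof.
apply/ffunP => i; rewrite vcastE.
case: (split_ordP i) => [a|c] ->; last first.
  rewrite (vcatR _ _ (b := rshift n c)) ?(vcatR _ _ (b := c)) //=.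
  by rewrite addnA.
rewrite (vcatL _ _ (a := a)) //; case: (split_ordP a) => b ->.
  by rewrite !(vcatL _ _ (a := b)).
rewrite (vcatR _ _ (b := lshift p b)) //.
by rewrite (vcatL _ _ (a := b)) // (vcatR _ _ (b := b)).
Qed.

Lemma vcat0v n (u : {ffun 'I_0 -> T}) (v : {ffun 'I_n -> T}) : vcat u v = v.
Proof. by apply/ffunP => i; rewrite (vcatR _ _ (b := i)). Qed.

Lemma vcatv0 n (u : {ffun 'I_0 -> T}) (v : {ffun 'I_n -> T}) :
  vcast (addn0 n) (vcat v u) = v.
Proof. by apply/ffunP => i; rewrite vcastE (vcatL _ _ (a := i)). Qed.

Lemma vact_otimes m n (s : 'S_m) (t : 'S_n) (v : {ffun 'I_m -> T}) (w : {ffun 'I_n -> T}) :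
  vact (otimes s t) (vcat v w) = vcat (vact s v) (vact t w).
Proof.
apply/ffunP => i; rewrite vactE permE /otimes_fun.
case: (split_ordP i) => a ->.
  by rewrite [RHS](vcatL _ _ (a := a)) // vactE (vcatL _ _ (a := s a)).
by rewrite [RHS](vcatR _ _ (b := a)) // vactE (vcatR _ _ (b := t a)).
Qed.

Lemma otimesV m n (s : 'S_m) (t : 'S_n) : ((otimes s t)^-1 = otimes s^-1 t^-1)%g.
Proof.
apply: (mulgI (otimes s t)); rewrite mulgV; apply/permP => i; rewrite permM perm1 !permE /otimes_fun.
case: (split_ordP i) => a ->.
  by rewrite (unsplitK (inl _)) permK.
by rewrite (unsplitK (inr _)) permK.
Qed.

(** Applied together with [vactK], this gives both sides of the commutation of
    horizontal concatenation with block permutations. *)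
Lemma vact_cblock m n (v : {ffun 'I_m -> T}) (w : {ffun 'I_n -> T}) :
  vact (cblock m n) (vcast (addnC n m) (vcat w v)) = vcat v w.
Proof.
apply/ffunP => i; rewrite vactE vcastE permE /cblock_fun.
case: (split_ordP i) => a -> /=.
  by rewrite [RHS](vcatL _ _ (a := a)) // (vcatR _ _ (b := a)).
by rewrite [RHS](vcatR _ _ (b := a)) // (vcatL _ _ (a := a)).
Qed.

Lemma vactK k (s : 'S_k) : cancel (@vact k s) (vact s^-1).
Proof. by move=> v; apply/ffunP => i; rewrite !ffunE permKV. Qed.

(** This is the defining property of [pdel]: deleting the letter at position i of
    the permuted word deletes the letter s i of v, and the permutation induced on
    the other positions is the standardization of s. *)
Lemma vdel_vact k (s : 'S_k.+1) i (v : {ffun 'I_k.+1 -> T}) :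
  vdel i (vact s v) = vact (pdel s (s i)) (vdel (s i) v).
Proof. by apply/ffunP => m; rewrite !ffunE permE lift_pdel_fun permK. Qed.

Lemma vdel_vactV k (s : 'S_k.+1) j (v : {ffun 'I_k.+1 -> T}) :
  vdel j (vact s^-1 v) = vact (pdel s j)^-1 (vdel ((s^-1)%g j) v).
Proof.
apply: (canRL (@vactK _ _)); have [i ->] : exists i, j = s i.
  by exists ((s^-1)%g j); rewrite permKV.
by rewrite -vdel_vact permK; congr vdel; rewrite -{1}[s]invgK vactK.
Qed.

Lemma vdel_vcatl m n (i : 'I_m.+1) (v : {ffun 'I_m.+1 -> T}) (w : {ffun 'I_n -> T}) :
  @vdel T (m + n) (lshift n i) (vcat v w) = vcat (vdel i v) w.
Proof.
apply/ffunP => a; rewrite vdelE; case: (split_ordP a) => b ->.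
  by rewrite [RHS](vcatL _ _ (a := b)) // vdelE (vcatL _ _ (a := lift i b)).
rewrite [RHS](vcatR _ _ (b := b)) //; apply: vcatR => /=.
rewrite /bump; have := ltn_ord i; lia.
Qed.

Lemma vdel_vcatr m n (i : 'I_n.+1) (v : {ffun 'I_m -> T}) (w : {ffun 'I_n.+1 -> T}) :
  vdel (cast_ord (addnS m n) (rshift m i)) (vcast (addnS m n) (vcat v w)) =
  vcat v (vdel i w).
Proof.
apply/ffunP => a; rewrite vdelE vcastE; case: (split_ordP a) => b ->.
  rewrite !(vcatL _ _ (a := b)) //=; rewrite /bump; have := ltn_ord b; lia.
rewrite [RHS](vcatR _ _ (b := b)) // vdelE (vcatR _ _ (b := lift i b)) //=.
by rewrite bumpDl.
Qed.

(** The hypotheses say that i and a are the two deleted positions, taken in the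
    two possible orders; i' and b are then the positions of the second deleted
    letter in the word from which the first one has been removed. *)
Lemma vdelC k (i a : 'I_k.+2) (i' b : 'I_k.+1) (v : {ffun 'I_k.+2 -> T}) :
  lift i i' = a -> lift a b = i -> vdel i' (vdel i v) = vdel b (vdel a v).
Proof.
move=> ea ei; apply/ffunP => m; rewrite !vdelE; congr (v _); apply: val_inj.
move/(congr1 val): ea; move/(congr1 val): ei => /=; rewrite /bump; lia.
Qed.

End Words.

(** * Words with one extra letter at an end *)

Section PcycleV.
Variables (n a b : nat).
Hypothesis ab : (a <= b < n)%N.

Lemma pcycleV_first (i m : 'I_n) : i = a :> nat -> m = b :> nat ->
  ((pcycle n a b)^-1)%g i = m.
Proof.
move=> ei em; apply: (canLR (permK _)); apply: val_inj.
by rewrite pcycleE // em ltnn andbF eqxx -ei.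
Qed.

Lemma pcycleV_in (i m : 'I_n) : (a < i <= b)%N -> i = m.+1 :> nat ->
  ((pcycle n a b)^-1)%g i = m.
Proof.
move=> iab ei; apply: (canLR (permK _)); apply: val_inj; rewrite pcycleE //.
by case: ifP => // /negP []; lia.
Qed.

Lemma pcycleV_out (i : 'I_n) : (b < i)%N -> ((pcycle n a b)^-1)%g i = i.
Proof.
move=> bi; apply: (canLR (permK _)); apply: val_inj; rewrite pcycleE //.
by rewrite ltnNge (ltnW bi) andbF gtn_eqF.
Qed.

End PcycleV.

Section Insertion.
Variables (K : fieldType) (W : vectType K) (n : nat).
Implicit Types (v : {ffun 'I_n -> W}) (i : 'I_n.+1) (x : W).

Lemma vdel_cons_first v x : @vdel W n ord0 (vcat [ffun _ : 'I_1 => x] v) = v.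
Proof. by apply/ffunP => m; rewrite vdelE; apply: vcatR. Qed.

Lemma vcat_cons_first v x : vcat [ffun _ : 'I_1 => x] v ord0 = x.
Proof. by rewrite (vcatL _ _ (a := ord0)) // ffunE. Qed.

Lemma vdel_rcons_last v x :
  vdel ord_max (vcast (addn1 n) (vcat v [ffun _ : 'I_1 => x])) = v.
Proof.
apply/ffunP => m; rewrite vdelE vcastE; apply: vcatL => /=.
by rewrite /bump leqNgt ltn_ord.
Qed.

Lemma vcat_rcons_last v x :
  vcast (addn1 n) (vcat v [ffun _ : 'I_1 => x]) ord_max = x.
Proof. by rewrite vcastE (vcatR _ _ (b := ord0)) ?ffunE //= addn0. Qed.

(** In the word x v, deleting the letter at i > 0, which is the letter i - 1 of v,
    leaves x in front.  So the outcome is v with its letter i - 1 moved to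
    the front by a cycle, and that letter replaced by x. *)
Lemma vdel_cons_rotate v i : (0 < i)%N ->
  exists m, let w := vact (pcycle n 0 i.-1)^-1 v in
    (forall x, vcat [ffun _ : 'I_1 => x] v i = w m) /\
    (forall x, @vdel W n i (vcat [ffun _ : 'I_1 => x] v) = vupd w m x).
Proof.
move=> i0; have lti := ltn_ord i.
have n0 : (0 < n)%N by lia.
have in' : (i.-1 < n)%N by lia.
exists (Ordinal n0); split=> x.
  rewrite vactE (@pcycleV_first _ _ _ _ _ (Ordinal in')) //.
  by apply: vcatR; exact/esym/prednK.
apply/ffunP => m; rewrite vdelE [RHS]ffunE vactE.
case: eqP => [->|/eqP m0].
  apply: (etrans (vcatL _ _ (a := ord0) _)); last by rewrite ffunE.
  by rewrite /= /bump leqNgt i0.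
have {}m0 : (0 < m)%N by rewrite lt0n.
have [mi|im] := ltnP m i.
  have pm : (m.-1 < n)%N by have := ltn_ord m; lia.
  rewrite (@pcycleV_in _ _ _ _ _ (Ordinal pm)) //=; try lia.
  by apply: vcatR => /=; rewrite /bump; lia.
rewrite pcycleV_out; try lia.
by apply: vcatR => /=; rewrite /bump; lia.
Qed.

(** The mirror image of [vdel_cons_rotate]: in the word v x the deleted letter is
    replaced by x at the last position. *)
Lemma vdel_rcons_rotate v i : (i < n)%N ->
  exists m, let w := vact (pcycle n i n.-1) v in
    (forall x, vcast (addn1 n) (vcat v [ffun _ : 'I_1 => x]) i = w m) /\
    (forall x, vdel i (vcast (addn1 n) (vcat v [ffun _ : 'I_1 => x])) = vupd w m x).
Proof.
move=> ltin; have pn : (n.-1 < n)%N by lia.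
have ab : (i <= n.-1 < n)%N by lia.
exists (Ordinal pn); split=> x.
  rewrite vactE vcastE; apply: vcatL.
  by rewrite pcycleE //= ltnn andbF eqxx.
apply/ffunP => m; rewrite vdelE vcastE [RHS]ffunE vactE.
case: eqP => [->|/eqP m0].
  by rewrite (vcatR _ _ (b := ord0)) ?ffunE //= /bump; lia.
have {}m0 : (m < n.-1)%N by have := ltn_ord m; move: m0; rewrite -val_eqE /=; lia.
apply: vcatL; rewrite pcycleE //= m0 andbT ltn_eqF // /bump.
by case: leqP.
Qed.

End Insertion.

(** * The structure maps on rank-one maps *)

Section HomV.
Variables (K : fieldType) (V : vectType K).

Local Notation homT k l := 'Hom(tpow V k, tpow V l).
Local Notation dualV := (dual V).

(** The rank-one maps span Hom, by finite dimension of V; this reduces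
    multilinear identities between maps to identities between words. *)
Lemma theta_ext k l (W : lmodType K) (F G : homT k l -> W) :
  linear F -> linear G ->
  (forall f v, F (theta f v) = G (theta f v)) -> F =1 G.
Proof.
move=> FL GL eFG p.
pose F' : {linear _ -> _} := HB.pack F (GRing.isLinear.Build K _ W _ F FL).
pose G' : {linear _ -> _} := HB.pack G (GRing.isLinear.Build K _ W _ G GL).
rewrite -[F]/(F' : _ -> _) -[G]/(G' : _ -> _).
have [c ->] := theta_span p.
rewrite !linear_sum; apply: eq_bigr => a _.
rewrite !linear_sum; apply: eq_bigr => b _.
by rewrite !linearZZ /= eFG.
Qed.

Lemma ptrace_theta k l i j (f : {ffun 'I_k.+1 -> dualV}) (v : {ffun 'I_l.+1 -> V}) :
  ptrace V i j (theta f v) = (f i (v j) : K) *: theta (vdel i f) (vdel j v).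
Proof. exact: ptraceP. Qed.

Lemma tperm_theta k l (s : 'S_l) (f : {ffun 'I_k -> dualV}) (v : {ffun 'I_l -> V}) :
  (tperm_fun V s \o theta f v)%VF = theta f (vact s^-1 v).
Proof.
apply/hom_tpowP => x.
by rewrite comp_lfunE !thetaE linearZZ /= tperm_funE.
Qed.

Lemma theta_tperm k l (s : 'S_k) (f : {ffun 'I_k -> dualV}) (v : {ffun 'I_l -> V}) :
  (theta f v \o tperm_fun V s)%VF = theta (vact s f) v.
Proof.
apply/hom_tpowP => x; rewrite comp_lfunE tperm_funE !thetaE; congr (_ *: _).
rewrite (reindex_inj (@perm_inj _ s)) /=; apply: eq_bigr => i _.
by rewrite !ffunE permK.
Qed.

Lemma hcat_theta k l k' l' (f : {ffun 'I_k -> dualV}) (v : {ffun 'I_l -> V})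
    (g : {ffun 'I_k' -> dualV}) (w : {ffun 'I_l' -> V}) :
  hcat_hom (theta f v) (theta g w) = theta (vcat f g) (vcat v w).
Proof.
apply/hom_tpowP => x; rewrite hcat_homE !thetaE !linearZZ /= scale_lfunE juxtE.
rewrite scalerA big_split_ord mulrC /=; congr (_ * _ *: _); apply: eq_bigr => i _.
  by rewrite (vcatL _ _ (a := i)) // ffunE.
by rewrite (vcatR _ _ (b := i)) // ffunE.
Qed.

Lemma hcat_linearl k l k' l' a (f f' : homT k l) (g : homT k' l') :
  hcat_hom (a *: f + f') g = a *: hcat_hom f g + hcat_hom f' g.
Proof.
apply/hom_tpowP => x.
by rewrite add_lfunE scale_lfunE !hcat_homE add_lfunE scale_lfunE linearP
  add_lfunE scale_lfunE.
Qed.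

Lemma hcat_linearr k l k' l' a (f : homT k l) (g g' : homT k' l') :
  hcat_hom f (a *: g + g') = a *: hcat_hom f g + hcat_hom f g'.
Proof.
apply/hom_tpowP => x.
by rewrite add_lfunE scale_lfunE !hcat_homE add_lfunE scale_lfunE linearP.
Qed.

Lemma hcatZl k l k' l' a (f : homT k l) (g : homT k' l') :
  hcat_hom (a *: f) g = a *: hcat_hom f g.
Proof.
by apply/hom_tpowP => x; rewrite scale_lfunE !hcat_homE scale_lfunE linearZZ /= scale_lfunE.
Qed.

Lemma hcatZr k l k' l' a (f : homT k l) (g : homT k' l') :
  hcat_hom f (a *: g) = a *: hcat_hom f g.
Proof.
by apply/hom_tpowP => x; rewrite scale_lfunE !hcat_homE scale_lfunE !linearZZ.
Qed.

(** The cast of the family of Hom spaces, at a type in which its linear structure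
    is visible. *)
Definition homcast k k' l l' (ek : k = k') (el : l = l') (p : homT k l) : homT k' l' :=
  @Defs.tcast (hom_trap V) k k' l l' ek el p.

Lemma homcast_linear k k' l l' (ek : k = k') (el : l = l') : linear (homcast ek el).
Proof. by case: _ / ek; case: _ / el. Qed.

Lemma homcast_theta k k' l l' (ek : k = k') (el : l = l')
    (f : {ffun 'I_k -> dualV}) (v : {ffun 'I_l -> V}) :
  homcast ek el (theta f v) = theta (vcast ek f) (vcast el v).
Proof.
by case: _ / ek; case: _ / el; congr theta; apply/ffunP => i;
  rewrite vcastE cast_ord_id.
Qed.

Lemma theta_multilinear_vectors k l (f : {ffun 'I_k -> dualV}) :
  multilinear (@theta K V k l f).
Proof.
move=> v i a x y; apply/hom_tpowP => z.
rewrite add_lfunE scale_lfunE !thetaE ten_multilinear.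
by rewrite scalerDr !scalerA mulrC.
Qed.

(** The forms themselves are letters in the vector space dual V, which lets the
    expansion of multilinear maps in a basis be used for them as well. *)
Lemma theta_multilinear_forms k l (v : {ffun 'I_l -> V}) :
  multilinear (fun f : {ffun 'I_k -> dualV} => theta f v).
Proof.
move=> f i a x y; apply/hom_tpowP => z.
rewrite add_lfunE scale_lfunE !thetaE scalerA -scalerDl; congr (_ *: _).
have updE h : \prod_m (vupd f i h m (z m) : K) = (h (z i) : K) * \prod_(m | m != i) (f m (z m) : K).
  rewrite (bigD1 i) //= ffunE eqxx; congr (_ * _).
  by apply: eq_bigr => m /negbTE ne; rewrite ffunE ne.
by rewrite !updE add_lfunE scale_lfunE mulrDl -mulrA.
Qed.

(** A basis of V and its dual basis. *)
Let bvec (a : 'I_(\dim {:V})) : V := (vbasis {:V})`_a.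
Let bform (a : 'I_(\dim {:V})) : dualV := linfun (coord (vbasis {:V}) a : V -> K^o).

Lemma id1_theta :
  \1%VF = \sum_a theta [ffun _ : 'I_1 => bform a] [ffun _ : 'I_1 => bvec a] :> homT 1 1.
Proof.
have [jL _] := tpow1_vectors V.
pose j : {linear _ -> _} := HB.pack (fun x : V => ten [ffun _ : 'I_1 => x])
  (GRing.isLinear.Build K _ _ _ _ jL).
apply/hom_tpowP => x; rewrite id_lfunE sum_lfunE.
have -> : ten x = j (x ord0).
  by rewrite /=; congr ten; apply/ffunP => i; rewrite ffunE ord1.
rewrite {1}(coord_vbasis (memvf (x ord0))) linear_sum; apply: eq_bigr => a _.
by rewrite linearZZ thetaE big_ord1 !ffunE lfunE.
Qed.

Lemma comp_linearl k l m a (f f' : homT l m) (g : homT k l) :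
  ((a *: f + f') \o g = a *: (f \o g) + (f' \o g))%VF.
Proof. by rewrite comp_lfunDl comp_lfunZl. Qed.

Lemma comp_linearr k l m a (f : homT l m) (g g' : homT k l) :
  (f \o (a *: g + g') = a *: (f \o g) + (f \o g'))%VF.
Proof. by rewrite comp_lfunDr comp_lfunZr. Qed.

Let linE := (hcat_linearl, hcat_linearr, homcast_linear, comp_linearl, comp_linearr).

(** * The axioms of a TRAP *)

Lemma hom_lactM k l (s s' : 'S_l) (p : homT k l) :
  (tperm_fun V s \o (tperm_fun V s' \o p) = tperm_fun V (s' * s)%g \o p)%VF.
Proof.
rewrite comp_lfunA; congr comp_lfun; apply/hom_tpowP => v.
rewrite comp_lfunE !tperm_funE; congr ten; apply/ffunP => i.
by rewrite !ffunE invMg permM.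
Qed.

Lemma hom_ractM k l (s s' : 'S_k) (p : homT k l) :
  ((p \o tperm_fun V s) \o tperm_fun V s' = p \o tperm_fun V (s' * s)%g)%VF.
Proof.
rewrite -comp_lfunA; congr comp_lfun; apply/hom_tpowP => v.
rewrite comp_lfunE !tperm_funE; congr ten; apply/ffunP => i.
by rewrite !ffunE invMg permM.
Qed.

Lemma tperm_fun1 k : tperm_fun V (1%g : 'S_k) = \1%VF.
Proof.
apply/hom_tpowP => v; rewrite tperm_funE id_lfunE; congr ten.
by apply/ffunP => i; rewrite ffunE invg1 perm1.
Qed.

Lemma hom_hcatA k l k' l' k'' l'' (p : homT k l) (p' : homT k' l') (p'' : homT k'' l'') :
  homcast (addnA k k' k'') (addnA l l' l'') (hcat_hom p (hcat_hom p' p'')) =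
  hcat_hom (hcat_hom p p') p''.
Proof.
move: p; apply: theta_ext => [a x y|a x y|f v]; rewrite ?linE //.
move: p'; apply: theta_ext => [a x y|a x y|f' v']; rewrite ?linE //.
move: p''; apply: theta_ext => [a x y|a x y|f'' v'']; rewrite ?linE //.
by rewrite !hcat_theta homcast_theta !vcatA.
Qed.

Lemma id0_theta : \1%VF = theta [ffun=> 0] [ffun=> 0] :> homT 0 0.
Proof.
apply/hom_tpowP => x; rewrite thetaE big_ord0 scale1r id_lfunE.
by congr ten; apply/ffunP => -[].
Qed.

Lemma hom_hcat0p k l (p : homT k l) : hcat_hom (\1%VF : homT 0 0) p = p.
Proof.
move: p; apply: theta_ext => [a x y|//|f v]; first by rewrite linE.
by rewrite id0_theta hcat_theta !vcat0v.
Qed.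

Lemma hom_hcatp0 k l (p : homT k l) :
  homcast (addn0 k) (addn0 l) (hcat_hom p (\1%VF : homT 0 0)) = p.
Proof.
move: p; apply: theta_ext => [a x y|//|f v]; first by rewrite !linE.
by rewrite id0_theta hcat_theta homcast_theta !vcatv0.
Qed.

Lemma hom_hcat_act k l k' l' (p : homT k l) (p' : homT k' l')
    (s : 'S_l) (t : 'S_k) (s' : 'S_l') (t' : 'S_k') :
  hcat_hom ((tperm_fun V s \o p) \o tperm_fun V t)%VF
           ((tperm_fun V s' \o p') \o tperm_fun V t')%VF =
  ((tperm_fun V (otimes s s') \o hcat_hom p p') \o tperm_fun V (otimes t t'))%VF.
Proof.
move: p; apply: theta_ext => [a x y|a x y|f v]; rewrite ?linE //.
move: p'; apply: theta_ext => [a x y|a x y|f' v']; rewrite ?linE //.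
rewrite hcat_theta !tperm_theta !theta_tperm hcat_theta.
by rewrite otimesV !vact_otimes.
Qed.

Lemma hom_hcatC k l k' l' (p : homT k l) (p' : homT k' l') :
  (tperm_fun V (cblock l l') \o hcat_hom p p' =
   homcast (addnC k' k) (addnC l' l) (hcat_hom p' p) \o tperm_fun V (cblock k k'))%VF.
Proof.
move: p; apply: theta_ext => [a x y|a x y|f v]; rewrite ?linE //.
move: p'; apply: theta_ext => [a x y|a x y|f' v']; rewrite ?linE //.
rewrite !hcat_theta homcast_theta tperm_theta theta_tperm vact_cblock.
by rewrite -(vact_cblock v v') vactK.
Qed.

(** The four rules for iterated traces at once.  They differ only in the way in
    which a pair of deleted positions is relabelled when the order of
    deletion is exchanged, and the hypotheses on [lift] describe this
    relabelling uniformly. *)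
Lemma hom_ptraceC k l (p : homT k.+2 l.+2) (i a : 'I_k.+2) (i' b : 'I_k.+1)
    (j c : 'I_l.+2) (j' q : 'I_l.+1) :
  lift i i' = a -> lift a b = i -> lift j j' = c -> lift c q = j ->
  ptrace V i' j' (ptrace V i j p) = ptrace V b q (ptrace V a c p).
Proof.
move=> ea ei ec ej; move: p; apply: theta_ext => [x y z|x y z|f v]; rewrite ?linearP //.
rewrite !ptrace_theta !linearZZ /= !ptrace_theta !scalerA.
rewrite (vdelC f ea ei) (vdelC v ec ej) !vdelE ea ei ec ej.
by rewrite mulrC.
Qed.

Lemma hom_ptrace_act k l (p : homT k.+1 l.+1) (s : 'S_l.+1) (t : 'S_k.+1) i j :
  ptrace V i j ((tperm_fun V s \o p) \o tperm_fun V t)%VF =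
  ((tperm_fun V (pdel s j) \o ptrace V (t i) ((s^-1)%g j) p)
     \o tperm_fun V (pdel t (t i)))%VF.
Proof.
move: p; apply: theta_ext => [a x y|a x y|f v]; rewrite ?(linE, linearP) //.
rewrite tperm_theta theta_tperm !ptrace_theta -comp_lfunZr -comp_lfunZl.
by rewrite tperm_theta theta_tperm !vactE vdel_vact vdel_vactV.
Qed.

Lemma hom_ptrace_hcatl k l k' l' (p : homT k.+1 l.+1) (p' : homT k' l')
    (i : 'I_k.+1) (j : 'I_l.+1) :
  @ptrace K V (k + k') (l + l') (lshift k' i) (lshift l' j) (hcat_hom p p') =
  hcat_hom (ptrace V i j p) p'.
Proof.
move: p; apply: theta_ext => [a x y|a x y|f v]; rewrite ?(linE, linearP) //.
move: p'; apply: theta_ext => [a x y|a x y|f' v']; rewrite ?(linE, linearP) //.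
rewrite hcat_theta !ptrace_theta hcatZl hcat_theta; congr (_ *: _).
  by rewrite (vcatL _ _ (a := i)) // (vcatL _ _ (a := j)).
by congr theta; apply: vdel_vcatl.
Qed.

Lemma hom_ptrace_hcatr k l k' l' (p : homT k l) (p' : homT k'.+1 l'.+1)
    (i : 'I_k'.+1) (j : 'I_l'.+1) :
  ptrace V (cast_ord (addnS k k') (rshift k i)) (cast_ord (addnS l l') (rshift l j))
    (homcast (addnS k k') (addnS l l') (hcat_hom p p')) =
  hcat_hom p (ptrace V i j p').
Proof.
move: p; apply: theta_ext => [a x y|a x y|f v]; rewrite ?(linE, linearP) //.
move: p'; apply: theta_ext => [a x y|a x y|f' v']; rewrite ?(linE, linearP) //.
rewrite hcat_theta homcast_theta !ptrace_theta hcatZr hcat_theta !vdel_vcatr.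
congr (_ *: _); rewrite !vcastE.
by rewrite (vcatR _ _ (b := i)) // (vcatR _ _ (b := j)).
Qed.

(** * The unit *)

Lemma hcat_suml k l k' l' (I : finType) (F : I -> homT k l) (g : homT k' l') :
  hcat_hom (\sum_a F a) g = \sum_a hcat_hom (F a) g.
Proof.
apply/hom_tpowP => x; rewrite sum_lfunE hcat_homE sum_lfunE linear_sum sum_lfunE.
by apply: eq_bigr => a _; rewrite hcat_homE.
Qed.

Lemma hcat_sumr k l k' l' (I : finType) (f : homT k l) (G : I -> homT k' l') :
  hcat_hom f (\sum_a G a) = \sum_a hcat_hom f (G a).
Proof.
apply/hom_tpowP => x; rewrite sum_lfunE hcat_homE sum_lfunE linear_sum.
by apply: eq_bigr => a _; rewrite hcat_homE.
Qed.

Lemma homcast_sum k k' l l' (ek : k = k') (el : l = l') (I : finType) (F : I -> homT k l) :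
  homcast ek el (\sum_a F a) = \sum_a homcast ek el (F a).
Proof. by case: _ / ek; case: _ / el. Qed.

(** Expands the letter w m in the basis: w m is the sum of the e^a(w m) e_a. *)
Lemma contract_vectors k l (f : {ffun 'I_k -> dualV}) (w : {ffun 'I_l -> V}) m :
  \sum_a (bform a (w m) : K) *: theta f (vupd w m (bvec a)) = theta f w.
Proof.
rewrite -multilinear_sum; last exact: theta_multilinear_vectors.
rewrite -[in RHS](vupd_same w m) [w m in RHS](coord_vbasis (memvf (w m))).
by congr (theta _ (vupd _ _ _)); apply: eq_bigr => a _; rewrite lfunE.
Qed.

(** Dually, g m is the sum of the (g m)(e_a) e^a. *)
Lemma contract_forms k l (g : {ffun 'I_k -> dualV}) (v : {ffun 'I_l -> V}) m :
  \sum_a (g m (bvec a) : K) *: theta (vupd g m (bform a)) v = theta g v.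
Proof.
rewrite -(multilinear_sum _ _ _ _ (@theta_multilinear_forms _ _ v)).
rewrite -[in RHS](vupd_same g m); congr (theta (vupd _ _ _) _).
apply/lfunP => x; rewrite sum_lfunE [in RHS](coord_vbasis (memvf x)) linear_sum.
by apply: eq_bigr => a _; rewrite scale_lfunE linearZZ lfunE /= [LHS]mulrC.
Qed.

Lemma hom_unit_ll k l (p : homT k l) (j : 'I_l.+1) : (0 < j)%N ->
  @ptrace K V k l ord0 j (hcat_hom (\1%VF : homT 1 1) p) =
  (tperm_fun V (pcycle l 0 j.-1) \o p)%VF.
Proof.
move=> j0; move: p; apply: theta_ext => [a x y|a x y|f v]; rewrite ?(linE, linearP) //.
rewrite id1_theta hcat_suml linear_sum tperm_theta.
have [m [wm vdelw]] := vdel_cons_rotate v j0.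
rewrite -[RHS](contract_vectors _ _ m); apply: eq_bigr => a _.
by rewrite hcat_theta /= (@ptrace_theta k l) vcat_cons_first wm vdel_cons_first vdelw.
Qed.

Lemma hom_unit_lr k l (p : homT k l) (i : 'I_k.+1) : (0 < i)%N ->
  @ptrace K V k l i ord0 (hcat_hom (\1%VF : homT 1 1) p) =
  (p \o tperm_fun V (pcycle k 0 i.-1)^-1%g)%VF.
Proof.
move=> i0; move: p; apply: theta_ext => [a x y|a x y|f v]; rewrite ?(linE, linearP) //.
rewrite id1_theta hcat_suml linear_sum theta_tperm.
have [m [wm vdelw]] := vdel_cons_rotate f i0.
rewrite -[RHS](contract_forms _ _ m); apply: eq_bigr => a _.
by rewrite hcat_theta /= (@ptrace_theta k l) vcat_cons_first wm vdel_cons_first vdelw.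
Qed.

Lemma hom_unit_rl k l (p : homT k l) (j : 'I_l.+1) : (j < l)%N ->
  ptrace V ord_max j (homcast (addn1 k) (addn1 l) (hcat_hom p (\1%VF : homT 1 1))) =
  (tperm_fun V (pcycle l j l.-1)^-1%g \o p)%VF.
Proof.
move=> ltjl; move: p; apply: theta_ext => [a x y|a x y|f v]; rewrite ?(linE, linearP) //.
rewrite id1_theta hcat_sumr homcast_sum linear_sum tperm_theta invgK.
have [m [wm vdelw]] := vdel_rcons_rotate v ltjl.
rewrite -[RHS](contract_vectors _ _ m); apply: eq_bigr => a _.
by rewrite hcat_theta homcast_theta /= ptrace_theta vcat_rcons_last wm vdel_rcons_last vdelw.
Qed.

Lemma hom_unit_rr k l (p : homT k l) (i : 'I_k.+1) : (i < k)%N ->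
  ptrace V i ord_max (homcast (addn1 k) (addn1 l) (hcat_hom p (\1%VF : homT 1 1))) =
  (p \o tperm_fun V (pcycle k i k.-1))%VF.
Proof.
move=> ltik; move: p; apply: theta_ext => [a x y|a x y|f v]; rewrite ?(linE, linearP) //.
rewrite id1_theta hcat_sumr homcast_sum linear_sum theta_tperm.
have [m [wm vdelw]] := vdel_rcons_rotate f ltik.
rewrite -[RHS](contract_forms _ _ m); apply: eq_bigr => a _.
by rewrite hcat_theta homcast_theta /= ptrace_theta vcat_rcons_last wm vdel_rcons_last vdelw.
Qed.

Lemma hom_is_trap : is_trap (hom_trap V).
Proof.
split.
- by move=> k l p; rewrite /= tperm_fun1 comp_lfun1l.
- by move=> k l s s' p; apply: hom_lactM.
- by move=> k l p; rewrite /= tperm_fun1 comp_lfun1r.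
- by move=> k l s s' p; apply: hom_ractM.
- by move=> k l s t p; rewrite /= comp_lfunA.
- exact: hom_hcatA.
- exact: hom_hcat0p.
- exact: hom_hcatp0.
- by move=> *; apply: hom_hcat_act.
- exact: hom_hcatC.
- move=> k l p i j i' j' lti ltj; have := (ltn_ord i, ltn_ord j) => -[hi hj].
  by apply: hom_ptraceC; apply: val_inj; rewrite /= ?inordK /bump; lia.
- move=> k l p i j i' j' lti ltj; have := (ltn_ord i', ltn_ord j) => -[hi hj].
  by apply: hom_ptraceC; apply: val_inj; rewrite /= ?inordK /bump; lia.
- move=> k l p i j i' j' lti ltj; have := (ltn_ord i, ltn_ord j') => -[hi hj].
  by apply: hom_ptraceC; apply: val_inj; rewrite /= ?inordK /bump; lia.
- move=> k l p i j i' j' lti ltj; have := (ltn_ord i', ltn_ord j') => -[hi hj].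
  by apply: hom_ptraceC; apply: val_inj; rewrite /= ?inordK /bump; lia.
- by move=> *; apply: hom_ptrace_act.
- exact: hom_ptrace_hcatl.
- exact: hom_ptrace_hcatr.
Qed.

Lemma hom_is_trap_unit : @is_trap_unit (hom_trap V) (hom_trap_unit V).
Proof.
split=> k l p q; first exact: hom_unit_ll; first exact: hom_unit_lr.
  exact: hom_unit_rl.
exact: hom_unit_rr.
Qed.

End HomV.

Theorem proposition2p1p1 (K : fieldType) (V : vectType K) :
  [/\ is_trap (hom_trap V),
      @is_trap_unit (hom_trap V) (hom_trap_unit V)
    & is_wheeled_prop (hom_trap V)].
Proof.
have trapV := hom_is_trap V; have unitV := @hom_is_trap_unit K V.
by split=> //; split=> //; exists (hom_trap_unit V).
Qed.
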